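(* Let $k>2$ and $\psi(x)=x^{k/2}$ for $x\ge0$. Then there is a constant $C_k>1$ such that for all $v,v_1,v_2\in\mathbb R^d$ with $\bm u=\binom{v_1-v}{v_2-v}\ne0$ one can write $K_{3,\psi}=\widetilde G_{3,\psi}-\widetilde L_{3,\psi}$, where $\widetilde G_{3,\psi},\widetilde L_{3,\psi}$ (functions of $(v,v_1,v_2)$) satisfy $$0\le\widetilde G_{3,\psi}\le\lambda_{k/2}\,C_k\big(\langle v\rangle\langle v_1\rangle+\langle v\rangle\langle v_2\rangle+\langle v_1\rangle\langle v_2\rangle\big)\big(\langle v\rangle^{k-2}+\langle v_1\rangle^{k-2}+\langle v_2\rangle^{k-2}\big),$$ $$\widetilde L_{3,\psi}\ge(\|b_3\|-\lambda_{k/2})\big(\langle v\rangle^k+\langle v_1\rangle^k+\langle v_2\rangle^k\big).$$ Additionally, if $\psi_n\nearrow\psi$ is the approximating sequence defined in the context, then for every $n$ one can write $K_{3,\psi_n}=\widetilde G_{3,\psi_n}-\widetilde L_{3,\psi_n}$, where $$0\le\widetilde G_{3,\psi_n}\le C_k\big(\langle v\rangle\langle v_1\rangle+\langle v\rangle\langle v_2\rangle+\langle v_1\rangle\langle v_2\rangle\big)\big(\langle v\rangle^{k-2}+\langle v_1\rangle^{k-2}+\langle v_2\rangle^{k-2}\big),$$ $$\widetilde L_{3,\psi_n}\ge0,\qquad\widetilde L_{3,\psi_n}\to\widetilde L_{3,\psi}\ \text{ as } n\to\infty.$$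
   Context: Let $d\ge2$, $\langle v\rangle=\sqrt{1+|v|^2}$. For $v,v_1,v_2\in\mathbb R^d$ and $\bm\omega=(\omega_1,\omega_2)\in\mathbb S^{2d-1}\subset\mathbb R^{2d}$ put $\bm u=(v_1-v,v_2-v)$, $\hat{\bm u}=\bm u/|\bm u|$, and $$v^*=v+c(\omega_1+\omega_2),\quad v_1^*=v_1-c\,\omega_1,\quad v_2^*=v_2-c\,\omega_2,\qquad c=\frac{\bm u\cdot\bm\omega}{1+\omega_1\cdot\omega_2}.$$ The angular kernel is $b_3:[-1,1]\times[-\tfrac12,\tfrac12]\to[0,\infty)$, $b_3(x,y)=|x|^{\theta_3}\phi(y)$ with $\theta_3\ge0$, $\phi\in L^\infty([-\tfrac12,\tfrac12])$, and $\|b_3\|:=\int_{\mathbb S^{2d-1}}b_3(\hat{\bm u}\cdot\bm\omega,\omega_1\cdot\omega_2)\,d\bm\omega<\infty$, which is taken as a standing property to be independent of the direction $\hat{\bm u}\in\mathbb S^{2d-1}$. The kernel $b_3$ is fixed; $C_k$ does not depend on $v,v_1,v_2,n$. For a nonnegative function $\psi$ on $[0,\infty)$ set $K_{3,\psi}=G_{3,\psi}-L_{3,\psi}$, where $$G_{3,\psi}(v,v_1,v_2)=\int_{\mathbb S^{2d-1}}b_3(\hat{\bm u}\cdot\bm\omega,\omega_1\cdot\omega_2)\big(\psi(\langle v^*\rangle^2)+\psi(\langle v_1^*\rangle^2)+\psi(\langle v_2^*\rangle^2)\big)d\bm\omega,$$ $$L_{3,\psi}(v,v_1,v_2)=\|b_3\|\big(\psi(\langle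 v\rangle^2)+\psi(\langle v_1\rangle^2)+\psi(\langle v_2\rangle^2)\big).$$ Ternary coercive map: $\{\lambda_{k/2}\}_{k\ge2}$ denotes a strictly decreasing map in $k$ with $\lambda_1=\|b_3\|$, $\lambda_{k/2}\to0$ as $k\to\infty$, such that for all $k\ge2$ and all $v,v_1,v_2$ with $\bm u\ne0$, $$\int_{\mathbb S^{2d-1}}b_3(\hat{\bm u}\cdot\bm\omega,\omega_1\cdot\omega_2)\big(\langle v^*\rangle^k+\langle v_1^*\rangle^k+\langle v_2^*\rangle^k\big)d\bm\omega\le\lambda_{k/2}\big(\langle v\rangle^2+\langle v_1\rangle^2+\langle v_2\rangle^2\big)^{k/2}.$$ Approximating sequence: for $n\in\mathbb N$, $n\ge1$, $\psi_n(x)=\psi(x)$ if $0\le x\le n$, and $\psi_n(x)=\psi'(n)x+\psi(n)-n\psi'(n)$ if $x>n$. *)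

(* Defs.v *)
From HB Require Import structures.
From mathcomp Require Import all_boot all_order all_algebra.
From mathcomp Require Import all_classical all_reals all_analysis.
From mathcomp Require Import measurable_realfun.

Set Implicit Arguments.
Unset Strict Implicit.
Unset Printing Implicit Defensive.
Import Order.TTheory GRing.Theory Num.Theory.
Import numFieldNormedType.Exports.
Local Open Scope classical_set_scope.
Local Open Scope ring_scope.

(* The norm carried by ['rV[R]_n] in the library is the sup norm, hence the
   explicit Euclidean structure below. *)
Definition dotp (R : realType) (n : nat) (x y : 'rV[R]_n) : R :=
  \sum_(i < n) x 0 i * y 0 i.

Definition enorm (R : realType) (n : nat) (x : 'rV[R]_n) : R :=
  Num.sqrt (dotp x x).

Definition japanese (R : realType) (n : nat) (x : 'rV[R]_n) : R :=
  Num.sqrt (1 + enorm x ^+ 2).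

(* Points of R^n are measured as tuples, on which the library puts the product
   sigma-algebra. *)
Definition row_of (R : realType) (n : nat) (t : n.-tuple (measurableTypeR R)) :
    'rV[R]_n :=
  \row_(i < n) (tnth t i : R).

Definition tcons (R : realType) (n : nat)
    (p : measurableTypeR R * n.-tuple (measurableTypeR R)) :
    n.+1.-tuple (measurableTypeR R) :=
  [the n.+1.-tuple _ of p.1 :: p.2].

Lemma measurable_tcons (R : realType) (n : nat) :
  measurable_fun setT (@tcons R n).
Proof.
exact: (@measurable_cons _ _ _ _ fst _ snd).
Qed.

Section pushforward_tcons.
Variables (R : realType) (n : nat).
Variable m0 : {sigma_finite_measure set (n.-tuple (measurableTypeR R)) -> \bar R}.
Local Notation m := (@lebesgue_measure R \x m0)%E.

Definition tcons_measure :
  set (n.+1.-tuple (measurableTypeR R)) -> \bar R := pushforward m (@tcons R n).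

Let tcons_measure0 : tcons_measure set0 = 0%E.
Proof. by rewrite /tcons_measure /pushforward preimage_set0 measure0. Qed.

Let tcons_measure_ge0 A : (0 <= tcons_measure A)%E.
Proof. by rewrite /tcons_measure /pushforward measure_ge0. Qed.

Let tcons_measure_sigma_additive : semi_sigma_additive tcons_measure.
Proof.
move=> F mF tF mUF; rewrite /tcons_measure /pushforward preimage_bigcup.
have mtF A : measurable A -> measurable (@tcons R n @^-1` A).
  by move=> mA; rewrite -[X in measurable X]setTI; exact: measurable_tcons.
apply: measure_semi_sigma_additive.
- by move=> i; exact: mtF.
- apply/trivIsetP => /= i j _ _ ij; rewrite -preimage_setI.
  by move/trivIsetP : tF => /(_ _ _ _ _ ij) ->//; rewrite preimage_set0.
- by rewrite -preimage_bigcup; exact: mtF.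
Qed.

HB.instance Definition _ := isMeasure.Build _ _ _ tcons_measure
  tcons_measure0 tcons_measure_ge0 tcons_measure_sigma_additive.

Let tcons_measure_sigma_finite : sigma_finite setT tcons_measure.
Proof.
have /sigma_finiteP[F [FT ndF mF]] := sigma_finiteT (@lebesgue_measure R).
have /sigma_finiteP[G [GT ndG mG]] := sigma_finiteT m0.
pose g (t : n.+1.-tuple (measurableTypeR R)) :
    measurableTypeR R * n.-tuple (measurableTypeR R) :=
  (tnth t ord0, [tuple of behead t]).
have mg : measurable_fun setT g.
  by apply: measurable_fun_pair; [exact: measurable_tnth|exact: measurable_behead].
have gK : cancel (@tcons R n) g.
  by case=> x t; rewrite /g/= (tnth_nth x)/=; congr (_, _); exact: val_inj.
exists (fun i => g @^-1` (F i `*` G i)) => [|i].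
  rewrite -preimage_bigcup (_ : \bigcup_i _ = setT) ?preimage_setT//.
  rewrite -subTset => -[x y] _.
  have [i _ Fx] : (\bigcup_i F i) x by rewrite -FT.
  have [j _ Gy] : (\bigcup_i G i) y by rewrite -GT.
  exists (maxn i j) => //; split => /=.
    by move: x Fx; exact/subsetPset/ndF/leq_maxl.
  by move: y Gy; exact/subsetPset/ndG/leq_maxr.
have [mFi Fi] := mF i; have [mGi Gi] := mG i; split.
  by rewrite -[X in measurable X]setTI; apply: mg => //; exact: measurableX.
rewrite /tcons_measure /pushforward -comp_preimage.
rewrite (_ : g \o _ = id); last by apply/funext => x; exact: gK.
by rewrite preimage_id product_measure1E// lte_mul_pinfty// ge0_fin_numE.
Qed.

HB.instance Definition _ := Measure_isSigmaFinite.Build _ _ _ tcons_measure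
  tcons_measure_sigma_finite.

End pushforward_tcons.

(* Lebesgue measure on R^n, as the n-fold product of the Lebesgue measure on R;
   R^0 carries the unit mass. *)
Fixpoint lebesgue_tuple (R : realType) (n : nat) :
    {sigma_finite_measure set (n.-tuple (measurableTypeR R)) -> \bar R} :=
  match n with
  | 0 => dirac ([tuple] : 0.-tuple (measurableTypeR R))
  | m.+1 => tcons_measure (lebesgue_tuple R m)
  end.

Definition tsphere (R : realType) (n : nat) :
    set (n.-tuple (measurableTypeR R)) :=
  [set t | enorm (row_of t) = 1].

Definition pball (R : realType) (n : nat) :
    set (n.-tuple (measurableTypeR R)) :=
  [set t | 0 < enorm (row_of t) <= 1].

Definition tnormalize (R : realType) (n : nat)
    (t : n.-tuple (measurableTypeR R)) : n.-tuple (measurableTypeR R) :=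
  [tuple (enorm (row_of t))^-1 * (tnth t i : R) | i < n].

Lemma measurable_enorm (R : realType) (n : nat) :
  measurable_fun setT (fun t : n.-tuple (measurableTypeR R) =>
    enorm (row_of t) : measurableTypeR R).
Proof.
rewrite /enorm /dotp.
apply: (@measurableT_comp _ _ _ _ _ _ (@Num.sqrt R)) => //.
  by apply: continuous_measurable_fun; exact: sqrt_continuous.
apply: measurable_sum => i; apply: measurable_funM.
  under eq_fun do rewrite mxE; exact: measurable_tnth.
under eq_fun do rewrite mxE; exact: measurable_tnth.
Qed.

Lemma measurable_pball (R : realType) (n : nat) : measurable (@pball R n).
Proof.
have -> : @pball R n =
    (fun t => enorm (row_of t) : measurableTypeR R) @^-1` `]0, 1]%classic.
  by apply/seteqP; split => t /=; rewrite in_itv.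
rewrite -[X in measurable X]setTI; exact: measurable_enorm.
Qed.

Lemma measurable_tnormalize (R : realType) (n : nat) :
  measurable_fun setT (@tnormalize R n).
Proof.
apply/measurable_fun_tnthP => i.
rewrite (_ : _ \o _ = fun t => (enorm (row_of t))^-1 * (tnth t i : R)); last first.
  by apply/funext => t /=; rewrite tnth_mktuple.
apply: measurable_funM; last exact: measurable_tnth.
under eq_fun do rewrite -powR_inv1 ?sqrtr_ge0//.
by apply: (@measurableT_comp _ _ _ _ _ _ (@powR R ^~ (-1))) => //;
  exact: measurable_enorm.
Qed.

(* Surface measure on the unit sphere of R^n, normalised as usual:
   sigma(A) = n |{x : 0 < |x| <= 1, x / |x| \in A}|, so that
   dx = r^(n-1) dr dsigma(w) in polar coordinates. *)
Definition sphere_measure (R : realType) (n : nat)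
    (A : set (n.-tuple (measurableTypeR R))) : \bar R :=
  (n%:R%:E * lebesgue_tuple R n (@pball R n `&` @tnormalize R n @^-1` A))%E.

Section sphere_measure_instance.
Variables (R : realType) (n : nat).
Local Notation sigma := (@sphere_measure R n).

Let sphere_measure0 : sigma set0 = 0%E.
Proof. by rewrite /sphere_measure preimage_set0 setI0 measure0 mule0. Qed.

Let sphere_measure_ge0 A : (0 <= sigma A)%E.
Proof. by rewrite /sphere_measure mule_ge0// lee_fin. Qed.

Let sphere_measure_sigma_additive : semi_sigma_additive sigma.
Proof.
have mN A : measurable A -> measurable (@tnormalize R n @^-1` A).
  by move=> mA; rewrite -[X in measurable X]setTI; exact: measurable_tnormalize.
have r0 : 0 <= n%:R :> R by [].
pose nu := mscale (NngNum r0)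
  (mrestr (lebesgue_tuple R n) (@measurable_pball R n)).
have nuE A : sigma A = nu (@tnormalize R n @^-1` A).
  by rewrite /sphere_measure /nu /mscale /mrestr/= setIC.
move=> F mF tF mUF.
rewrite (_ : (fun m => _) =
  (fun m => \sum_(0 <= i < m) nu (@tnormalize R n @^-1` F i))%E); last first.
  by apply/funext => m; apply: eq_bigr => i _.
rewrite nuE preimage_bigcup; apply: measure_semi_sigma_additive.
- by move=> i; exact: mN.
- apply/trivIsetP => /= i j _ _ ij; rewrite -preimage_setI.
  by move/trivIsetP : tF => /(_ _ _ _ _ ij) ->//; rewrite preimage_set0.
- by rewrite -preimage_bigcup; exact: mN.
Qed.

HB.instance Definition _ := isMeasure.Build _ _ _ sigma
  sphere_measure0 sphere_measure_ge0 sphere_measure_sigma_additive.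

End sphere_measure_instance.

Definition sphere_integral (R : realType) (n : nat) (F : 'rV[R]_n -> \bar R) :
    \bar R :=
  (\int[@sphere_measure R n]_(t in @tsphere R n) F (row_of t))%E.

(* A point [u] or [w] of R^(2d) is a row of size [d + d]; its two R^d components
   are [lsubmx] and [rsubmx]. *)
Definition relvel (R : realType) (d : nat) (v v1 v2 : 'rV[R]_d) : 'rV[R]_(d + d) :=
  row_mx (v1 - v) (v2 - v).

Definition udir (R : realType) (n : nat) (u : 'rV[R]_n) : 'rV[R]_n :=
  (enorm u)^-1 *: u.

Definition coll (R : realType) (d : nat) (u w : 'rV[R]_(d + d)) : R :=
  dotp u w / (1 + dotp (lsubmx w) (rsubmx w)).

Definition post0 (R : realType) (d : nat) (v v1 v2 : 'rV[R]_d)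
    (w : 'rV[R]_(d + d)) : 'rV[R]_d :=
  v + coll (relvel v v1 v2) w *: (lsubmx w + rsubmx w).

Definition post1 (R : realType) (d : nat) (v v1 v2 : 'rV[R]_d)
    (w : 'rV[R]_(d + d)) : 'rV[R]_d :=
  v1 - coll (relvel v v1 v2) w *: lsubmx w.

Definition post2 (R : realType) (d : nat) (v v1 v2 : 'rV[R]_d)
    (w : 'rV[R]_(d + d)) : 'rV[R]_d :=
  v2 - coll (relvel v v1 v2) w *: rsubmx w.

Definition b3 (R : realType) (theta3 : R) (phi : R -> R) (x y : R) : R :=
  `|x| `^ theta3 * phi y.

(* b_3 evaluated at the arguments (e . w, w_1 . w_2), for a direction [e]. *)
Definition b3_at (R : realType) (d : nat) (theta3 : R) (phi : R -> R)
    (e w : 'rV[R]_(d + d)) : R :=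
  b3 theta3 phi (dotp e w) (dotp (lsubmx w) (rsubmx w)).

Definition half_itv (R : realType) : set R := `[- 2^-1, 2^-1]%classic.

(* Standing assumptions on the angular kernel; the last one says at once that
   ||b_3|| is finite, equal to [nb], and independent of the direction. *)
Definition angular_kernel (R : realType) (d : nat) (theta3 : R) (phi : R -> R)
    (nb : R) : Prop :=
  [/\ 0 <= theta3,
      forall y, half_itv y -> 0 <= phi y,
      phi \_ (@half_itv R) \in Lfun (@lebesgue_measure R) +oo%E &
      forall e : 'rV[R]_(d + d), enorm e = 1 ->
        sphere_integral (fun w => (b3_at theta3 phi e w)%:E) = nb%:E].

Definition gain (R : realType) (d : nat) (theta3 : R) (phi psi : R -> R)
    (v v1 v2 : 'rV[R]_d) : \bar R :=
  sphere_integral (fun w =>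
    (b3_at theta3 phi (udir (relvel v v1 v2)) w *
      (psi (japanese (post0 v v1 v2 w) ^+ 2) +
       psi (japanese (post1 v v1 v2 w) ^+ 2) +
       psi (japanese (post2 v v1 v2 w) ^+ 2)))%:E).

Definition loss (R : realType) (d : nat) (nb : R) (psi : R -> R)
    (v v1 v2 : 'rV[R]_d) : R :=
  nb * (psi (japanese v ^+ 2) + psi (japanese v1 ^+ 2) + psi (japanese v2 ^+ 2)).

Definition K3 (R : realType) (d : nat) (theta3 : R) (phi : R -> R) (nb : R)
    (psi : R -> R) (v v1 v2 : 'rV[R]_d) : \bar R :=
  (gain theta3 phi psi v v1 v2 - (loss nb psi v v1 v2)%:E)%E.

(* [lam p] is lambda_p for real p >= 1, so that lambda_{k/2} is [lam (k / 2)]. *)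
Definition ternary_coercive_map (R : realType) (d : nat) (theta3 : R)
    (phi : R -> R) (nb : R) (lam : R -> R) : Prop :=
  [/\ lam 1 = nb,
      forall k l : R, 2 <= k -> k < l -> lam (l / 2) < lam (k / 2),
      lam (k / 2) @[k --> +oo] --> (0 : R) &
      forall (k : R) (v v1 v2 : 'rV[R]_d), 2 <= k -> relvel v v1 v2 != 0 ->
        (sphere_integral (fun w =>
           (b3_at theta3 phi (udir (relvel v v1 v2)) w *
             (japanese (post0 v v1 v2 w) `^ k +
              japanese (post1 v v1 v2 w) `^ k +
              japanese (post2 v v1 v2 w) `^ k))%:E)
         <= (lam (k / 2) *
              (japanese v ^+ 2 + japanese v1 ^+ 2 + japanese v2 ^+ 2) `^ (k / 2))%:E)%E].

Definition psi_approx (R : realType) (psi : R -> R) (n : nat) (x : R) : R :=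
  if x <= n%:R then psi x
  else derive1 psi n%:R * x + psi n%:R - n%:R * derive1 psi n%:R.

Definition cross_weight (R : realType) (d : nat) (k : R) (v v1 v2 : 'rV[R]_d) : R :=
  (japanese v * japanese v1 + japanese v * japanese v2 +
    japanese v1 * japanese v2) *
  (japanese v `^ (k - 2) + japanese v1 `^ (k - 2) + japanese v2 `^ (k - 2)).

(* Main.v *)
Require Import Defs.
From HB Require Import structures.
From mathcomp Require Import all_boot all_order all_algebra.
From mathcomp Require Import all_classical all_reals all_analysis.
From mathcomp Require Import ring lra.

Set Implicit Arguments.
Unset Strict Implicit.

Import Order.TTheory GRing.Theory Num.Theory.
Import numFieldNormedType.Exports.
Local Open Scope classical_set_scope.
Local Open Scope ring_scope.

(* With E the conserved sum of the three squared brackets and S the sum of psi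
   over them, put G~ = max(0, gain - lambda S) and L~ = loss - gain + G~.  The
   coercive estimate bounds the gain by lambda psi(E), and psi(E) - S is a
   cross term: when a is the largest of the three, it is at most
   psi(E) - psi(a) <= psi'(E) (E - a), with E <= 3 a.
   The same works for psi_n with lambda replaced by ||b_3||, because
   psi_n(x) / x is nondecreasing, hence psi_n is superadditive and
   gain_n <= ||b_3|| psi_n(E).  All post-collisional arguments are at most E, so
   for n >= E nothing distinguishes psi_n from psi; using the first decomposition
   for such n makes L~_n eventually equal to L~. *)

(* Young's inequality for the conjugate exponents p and p / (p - 1). *)
Lemma powR_sub_le (R : realType) (p x y : R) : 1 < p -> 0 <= x -> 0 <= y ->
  y `^ p - x `^ p <= p * y `^ (p - 1) * (y - x).
Proof.
move=> p1 x0 y0; have p0 : 0 < p by lra.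
have pB0 : 0 < p - 1 by lra.
have yp : y * y `^ (p - 1) = y `^ p by apply: mulr_powRB1.
have := @conjugate_powR R x (y `^ (p - 1)) p (p / (p - 1)) x0 (powR_ge0 _ _) p0.
rewrite divr_gt0// => /(_ isT).
have -> : p^-1 + (p / (p - 1))^-1 = 1 by field; rewrite !gt_eqF.
move=> /(_ erefl); rewrite -powRrM.
have -> : (p - 1) * (p / (p - 1)) = p by field; rewrite !gt_eqF.
rewrite -(ler_pM2l p0).
have -> : p * (x `^ p / p + y `^ p / (p / (p - 1))) = x `^ p + (p - 1) * y `^ p.
  by field; rewrite !gt_eqF.
nra.
Qed.

(** * Convexity estimates for the approximants of a power *)

Section psi_approx_power.
Variables (R : realType) (p : R) (n : nat).
Hypotheses (p1 : 1 < p) (n1 : (1 <= n)%N).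
Local Notation psin := (psi_approx (fun x : R => x `^ p) n).

(** The tangent line at [n], with the common factor [n^(p-1)] pulled out so that later comparisons
    beyond [n] become linear in [x]. *)
Lemma psi_approx_powR x : n%:R < x ->
  psin x = n%:R `^ (p - 1) * (p * x - (p - 1) * n%:R).
Proof.
move=> nx; have n0 : 0 < n%:R :> R by rewrite ltr0n.
rewrite /psi_approx leNgt nx /= powR_derive1 ?in_itv/= ?n0//.
rewrite -(@mulr_powRB1 R n%:R p) ?ltW//; first by ring.
by rewrite (lt_trans _ p1).
Qed.

Lemma psi_approx_powR_gt0 x : 0 < x -> 0 < psin x.
Proof.
move=> x0; have [xn|nx] := leP x n%:R; first by rewrite /psi_approx xn powR_gt0.
rewrite psi_approx_powR// mulr_gt0 ?powR_gt0 ?ltr0n//.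
have : 0 <= (p - 1) * (x - n%:R) by apply: mulr_ge0; rewrite subr_ge0 ltW.
lra.
Qed.

Lemma psi_approx_powR_ge0 x : 0 <= psin x.
Proof.
have [x0|x0] := ltP 0 x; first exact/ltW/psi_approx_powR_gt0.
by rewrite /psi_approx (le_trans x0)// powR_ge0.
Qed.

(* Monotonicity of psi_n x / x, cleared of denominators. *)
Lemma psi_approx_powR_slope x y : 0 <= x -> x <= y -> psin x * y <= psin y * x.
Proof.
move=> x0 xy; have y0 := le_trans x0 xy.
have p0 : 0 < p by rewrite (lt_trans _ p1).
have pB0 : 0 <= p - 1 by rewrite subr_ge0 ltW.
have mono (a b : R) : 0 <= a -> a <= b -> a `^ (p - 1) <= b `^ (p - 1).
  by move=> a0 ab; apply: ge0_ler_powR; rewrite ?nnegrE// (le_trans a0).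
have n0 : 0 <= n%:R :> R by [].
have [yn|ny] := leP y n%:R.
  rewrite /psi_approx (le_trans xy yn) yn.
  rewrite -(@mulr_powRB1 R x p)// -(@mulr_powRB1 R y p)//.
  have := mono _ _ x0 xy; have := mulr_ge0 x0 y0; nra.
have qn0 : 0 <= n%:R `^ (p - 1) :> R by exact: powR_ge0.
rewrite (psi_approx_powR ny).
have [xn|nx] := leP x n%:R.
  rewrite {1}/psi_approx xn -(@mulr_powRB1 R x p)//.
  have q : x `^ (p - 1) <= n%:R `^ (p - 1) by exact: mono.
  apply: (@le_trans _ _ (x * n%:R `^ (p - 1) * y)).
    by rewrite ler_wpM2r// ler_wpM2l.
  rewrite [leRHS]mulrC mulrA ler_wpM2l ?mulr_ge0//.
  have : 0 <= (p - 1) * (y - n%:R) by apply: mulr_ge0 => //; rewrite subr_ge0 ltW.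
  lra.
rewrite psi_approx_powR// -!mulrA ler_wpM2l//.
have := ler_wpM2l (mulr_ge0 pB0 n0) xy; nra.
Qed.

(** Add the slope inequalities of the three summands against the total [s = x + y + z], then cancel
    [s > 0]. *)
Lemma psi_approx_powR_sum x y z : 0 <= x -> 0 <= y -> 0 <= z -> 0 < x + y + z ->
  psin x + psin y + psin z <= psin (x + y + z).
Proof.
move=> x0 y0 z0 s0; rewrite -(ler_pM2r s0).
have := @psi_approx_powR_slope x (x + y + z) x0.
have := @psi_approx_powR_slope y (x + y + z) y0.
have := @psi_approx_powR_slope z (x + y + z) z0.
move: (psin (x + y + z)) => P Z Y X.
have {}Z : psin z * (x + y + z) <= P * z by apply: Z; lra.
have {}Y : psin y * (x + y + z) <= P * y by apply: Y; lra.
have {}X : psin x * (x + y + z) <= P * x by apply: X; lra.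
lra.
Qed.

(** Convexity, with the slope at [y] replaced by that of the full power: beyond [n] the slope is
    frozen at [p * n^(p-1)], which is at most [p * y^(p-1)]. *)
Lemma psi_approx_powR_sub x y : 0 <= x -> x <= y ->
  psin y - psin x <= p * y `^ (p - 1) * (y - x).
Proof.
move=> x0 xy; have y0 := le_trans x0 xy.
have n0 : 0 <= n%:R :> R by [].
have p0 : 0 < p by rewrite (lt_trans _ p1).
have pB0 : 0 <= p - 1 by rewrite subr_ge0 ltW.
have [yn|ny] := leP y n%:R.
  by rewrite /psi_approx (le_trans xy yn) yn; exact: powR_sub_le.
have q : n%:R `^ (p - 1) <= y `^ (p - 1).
  by apply: ge0_ler_powR; rewrite ?nnegrE// ltW.
apply: (@le_trans _ _ (p * n%:R `^ (p - 1) * (y - x))); last first.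
  by rewrite ler_wpM2r ?subr_ge0// ler_wpM2l// ltW.
rewrite (psi_approx_powR ny).
(* If [x <= n < y], the increment splits at [n]: the power bound from [x] to [n], affine growth from
   [n] to [y]. *)
have [xn|nx] := leP x n%:R; last by rewrite psi_approx_powR//; lra.
rewrite /psi_approx xn; have := powR_sub_le p1 x0 n0.
by rewrite -(@mulr_powRB1 R n%:R p)//; lra.
Qed.

End psi_approx_power.

(** * The cross-term estimate *)

Section psi_approx_cross.
Variables (R : realType) (k : R) (n : nat).
Hypotheses (k2 : 2 < k) (n1 : (1 <= n)%N).
Local Notation psin := (psi_approx (fun x : R => x `^ (k / 2)) n).

(** The argument grows by [y^2 + z^2 <= x * y + x * z], and the total is at most [3 * x^2]; this is
    the origin of the factor [3^(k/2 - 1)]. *)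
Lemma psi_approx_cross_max (x y z : R) :
  0 <= y -> 0 <= z -> y <= x -> z <= x ->
  psin (x ^+ 2 + y ^+ 2 + z ^+ 2) - psin (x ^+ 2) <=
    k / 2 * 3 `^ (k / 2 - 1) * ((x * y + x * z) * x `^ (k - 2)).
Proof.
move=> y0 z0 yx zx; have p1 : 1 < k / 2 by rewrite ltr_pdivlMr ?mul1r.
have x0 := le_trans y0 yx.
have y2 : y ^+ 2 <= x * y by rewrite expr2 ler_wpM2r.
have z2 : z ^+ 2 <= x * z by rewrite expr2 ler_wpM2r.
have xy : x * y <= x ^+ 2 by rewrite expr2 ler_wpM2l.
have xz : x * z <= x ^+ 2 by rewrite expr2 ler_wpM2l.
have [x20 y20 z20] := And3 (sqr_ge0 x) (sqr_ge0 y) (sqr_ge0 z).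
apply: le_trans (psi_approx_powR_sub p1 n1 x20 _) _; first lra.
have -> : x `^ (k - 2) = (x ^+ 2) `^ (k / 2 - 1).
  by rewrite -powR_mulrn// -powRrM; congr (_ `^ _); field.
have E : (x ^+ 2 + y ^+ 2 + z ^+ 2) `^ (k / 2 - 1) <=
    3 `^ (k / 2 - 1) * (x ^+ 2) `^ (k / 2 - 1).
  rewrite -powRM ?sqr_ge0//; apply: ge0_ler_powR; rewrite ?nnegrE; lra.
rewrite -[leLHS]mulrA -[leRHS]mulrA ler_pM2l; last lra.
rewrite [leRHS]mulrCA [leLHS]mulrC; apply: ler_pM => //; rewrite ?powR_ge0//; lra.
Qed.

Lemma psi_approx_cross (x y z : R) :
  0 <= x -> 0 <= y -> 0 <= z ->
  psin (x ^+ 2 + y ^+ 2 + z ^+ 2) - (psin (x ^+ 2) + psin (y ^+ 2) + psin (z ^+ 2)) <=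
    k / 2 * 3 `^ (k / 2 - 1) *
    ((x * y + x * z + y * z) * (x `^ (k - 2) + y `^ (k - 2) + z `^ (k - 2))).
Proof.
have p1 : 1 < k / 2 by rewrite ltr_pdivlMr ?mul1r.
(* Both sides are symmetric, so the largest variable may be put first. *)
wlog : x y z / (y <= x) && (z <= x).
  move=> W x0 y0 z0; have [yx|xy] := leP y x; have [zx|xz] := leP z x.
  - by apply: W => //; rewrite yx.
  - have := W z x y; rewrite (ltW xz) (le_trans yx (ltW xz)) => /(_ isT z0 x0 y0).
    rewrite (_ : z ^+ 2 + x ^+ 2 + y ^+ 2 = x ^+ 2 + y ^+ 2 + z ^+ 2); last by ring.
    lra.
  - have := W y x z; rewrite (ltW xy) (le_trans zx (ltW xy)) => /(_ isT y0 x0 z0).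
    rewrite (_ : y ^+ 2 + x ^+ 2 + z ^+ 2 = x ^+ 2 + y ^+ 2 + z ^+ 2); last by ring.
    lra.
  - have [yz|zy] := leP y z.
      have := W z x y; rewrite (ltW xz) yz => /(_ isT z0 x0 y0).
      rewrite (_ : z ^+ 2 + x ^+ 2 + y ^+ 2 = x ^+ 2 + y ^+ 2 + z ^+ 2); last by ring.
      lra.
    have := W y x z; rewrite (ltW xy) (ltW zy) => /(_ isT y0 x0 z0).
    rewrite (_ : y ^+ 2 + x ^+ 2 + z ^+ 2 = x ^+ 2 + y ^+ 2 + z ^+ 2); last by ring.
    lra.
move=> /andP[yx zx] x0 y0 z0.
have := @psi_approx_cross_max x y z y0 z0 yx zx => M.
have := psi_approx_powR_ge0 p1 n1 (y ^+ 2); have := psi_approx_powR_ge0 p1 n1 (z ^+ 2).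
move=> Z0 Y0.
apply: le_trans (_ : psin (x ^+ 2 + y ^+ 2 + z ^+ 2) - psin (x ^+ 2) <= _); first lra.
apply: le_trans M _; rewrite ler_wpM2l ?mulr_ge0 ?powR_ge0//; first lra.
apply: ler_pM; rewrite ?addr_ge0 ?mulr_ge0 ?powR_ge0//.
  by rewrite lerDl mulr_ge0.
by rewrite -addrA lerDl addr_ge0 ?powR_ge0.
Qed.

End psi_approx_cross.

(** * Euclidean geometry of the collision *)

Lemma dotpC (R : realType) n (x y : 'rV[R]_n) : dotp x y = dotp y x.
Proof. by apply: eq_bigr => i _; rewrite mulrC. Qed.

Lemma dotpDl (R : realType) n (x y z : 'rV[R]_n) :
  dotp (x + y) z = dotp x z + dotp y z.
Proof. by rewrite -big_split; apply: eq_bigr => i _; rewrite mxE mulrDl. Qed.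

Lemma dotpDr (R : realType) n (x y z : 'rV[R]_n) :
  dotp x (y + z) = dotp x y + dotp x z.
Proof. by rewrite dotpC dotpDl !(dotpC x). Qed.

Lemma dotpZl (R : realType) n a (x y : 'rV[R]_n) :
  dotp (a *: x) y = a * dotp x y.
Proof. by rewrite mulr_sumr; apply: eq_bigr => i _; rewrite mxE mulrA. Qed.

Lemma dotpZr (R : realType) n a (x y : 'rV[R]_n) :
  dotp x (a *: y) = a * dotp x y.
Proof. by rewrite dotpC dotpZl dotpC. Qed.

Lemma dotp_ge0 (R : realType) n (x : 'rV[R]_n) : 0 <= dotp x x.
Proof. by apply: sumr_ge0 => i _; rewrite -expr2 sqr_ge0. Qed.

Lemma dotp_eq0 (R : realType) n (x : 'rV[R]_n) : (dotp x x == 0) = (x == 0).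
Proof.
apply/eqP/eqP => [/eqP|->]; last by rewrite /dotp big1// => i _; rewrite !mxE mul0r.
rewrite psumr_eq0 => [/allP x0|i _]; last by rewrite -expr2 sqr_ge0.
apply/rowP => i; have := x0 i (mem_index_enum _).
by rewrite mulf_eq0 orbb mxE => /eqP.
Qed.

Lemma dotp_split (R : realType) n1 n2 (x y : 'rV[R]_(n1 + n2)) :
  dotp x y = dotp (lsubmx x) (lsubmx y) + dotp (rsubmx x) (rsubmx y).
Proof.
by rewrite /dotp big_split_ord; congr (_ + _); apply: eq_bigr => i _; rewrite !mxE.
Qed.

Lemma enorm_udir (R : realType) n (u : 'rV[R]_n) : u != 0 -> enorm (udir u) = 1.
Proof.
move=> u0; have d0 : 0 < dotp u u by rewrite lt0r dotp_eq0 u0 dotp_ge0.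
have e0 : enorm u != 0 by rewrite gt_eqF// sqrtr_gt0.
have e2 : dotp u u = enorm u * enorm u by rewrite -expr2 sqr_sqrtr ?ltW.
by rewrite /enorm /udir dotpZl dotpZr e2 mulKf// mulVf// sqrtr1.
Qed.

Lemma japanese_sqr (R : realType) n (x : 'rV[R]_n) :
  japanese x ^+ 2 = 1 + dotp x x.
Proof. by rewrite !sqr_sqrtr ?dotp_ge0// addr_ge0// dotp_ge0. Qed.

(** Expand [|w_1 + w_2|^2 >= 0] and [|w_1 - w_2|^2 >= 0] using [|w_1|^2 + |w_2|^2 = 1]. This places
    the argument of [phi] where it is nonnegative and keeps the denominator of [coll] positive. *)
Lemma half_itv_dotp (R : realType) d (w : 'rV[R]_(d + d)) : enorm w = 1 ->
  half_itv (dotp (lsubmx w) (rsubmx w)).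
Proof.
move=> w1; have : dotp w w = 1 by rewrite -(sqr_sqrtr (dotp_ge0 w)) -/(enorm w) w1 expr1n.
rewrite dotp_split /half_itv /= in_itv /=.
have := dotp_ge0 (lsubmx w + rsubmx w).
have := dotp_ge0 (lsubmx w + (- 1) *: rsubmx w).
rewrite !(dotpDl, dotpDr, dotpZl, dotpZr) (dotpC (rsubmx w) (lsubmx w)); lra.
Qed.

(** With [c] the collision coefficient, the energy changes by [-2c (u . w) + c^2 (|w_1 + w_2|^2 +
    |w_1|^2 + |w_2|^2)]. On the sphere the last bracket is [2 (1 + w_1 . w_2)], so the definition of
    [c] makes the change vanish. *)
Lemma post_energy (R : realType) d (v v1 v2 : 'rV[R]_d) (w : 'rV[R]_(d + d)) :
  enorm w = 1 ->
  japanese (post0 v v1 v2 w) ^+ 2 + japanese (post1 v v1 v2 w) ^+ 2 +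
    japanese (post2 v v1 v2 w) ^+ 2 =
  japanese v ^+ 2 + japanese v1 ^+ 2 + japanese v2 ^+ 2.
Proof.
move=> w1; have := half_itv_dotp w1; rewrite /half_itv /= in_itv /= => /andP[lr _].
have : dotp w w = 1 by rewrite -(sqr_sqrtr (dotp_ge0 w)) -/(enorm w) w1 expr1n.
rewrite dotp_split => ww.
have : coll (relvel v v1 v2) w * (1 + dotp (lsubmx w) (rsubmx w)) =
    dotp (relvel v v1 v2) w by rewrite /coll divfK// gt_eqF//; lra.
rewrite [in RHS]dotp_split /relvel row_mxKl row_mxKr.
rewrite !japanese_sqr /post0 /post1 /post2 /relvel.
move: (coll _ _) (lsubmx w) (rsubmx w) lr ww => c l r lr ww.
rewrite -!scaleNr -(scaleN1r v).
rewrite !(dotpDl, dotpDr, dotpZl, dotpZr) (dotpC r l) (dotpC l v) (dotpC r v).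
rewrite (dotpC l v1) (dotpC r v2).
nra.
Qed.

Section integral_scale_bound.
Local Open Scope ereal_scope.
Import HBNNSimple.

(* Neither function is assumed measurable: only the supremum over simple
   functions is used. *)
Lemma ge0_integral_leZ dT (T : measurableType dT) (R : realType)
    (mu : {measure set T -> \bar R}) (D : set T) (f g : T -> \bar R) (r : R) :
  (0 < r)%R -> (forall x, D x -> 0 <= f x) ->
  (forall x, D x -> f x <= r%:E * g x) ->
  \int[mu]_(x in D) f x <= r%:E * \int[mu]_(x in D) g x.
Proof.
move=> r0 f0 fg.
have g0 x : D x -> 0 <= g x.
  by move=> Dx; have := le_trans (f0 _ Dx) (fg _ Dx); rewrite pmule_rge0// lte_fin.
rewrite !ge0_integralE//; apply: ge_ereal_sup => _ [h /= hf <-].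
rewrite -lee_pdivrMl// -sintegralrM; apply: ereal_sup_ubound => /=.
have ri0 : (0 <= r^-1)%R by rewrite invr_ge0 ltW.
exists (scale_nnsfun h ri0) => //= x; rewrite EFinM lee_pdivrMl//.
apply: le_trans (hf x) _; rewrite /patch; case: ifPn => [/set_mem/fg//|_].
by rewrite mule0.
Qed.

End integral_scale_bound.

(** * From pointwise energy conservation to the gain term *)

Section gain_bounds.
Variables (R : realType) (d : nat) (theta3 : R) (phi : R -> R) (nb : R).
Hypothesis hb3 : angular_kernel d theta3 phi nb.

Lemma b3_at_ge0 (e w : 'rV[R]_(d + d)) : enorm w = 1 -> 0 <= b3_at theta3 phi e w.
Proof.
case: hb3 => _ phi0 _ _ w1.
by rewrite mulr_ge0 ?powR_ge0// phi0//; exact: half_itv_dotp.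
Qed.

Lemma gain_ge0 psi (v v1 v2 : 'rV[R]_d) : (forall x, 0 <= psi x) ->
  (0 <= gain theta3 phi psi v v1 v2)%E.
Proof.
move=> psi0; apply: integral_ge0 => t t1.
by rewrite lee_fin mulr_ge0 ?b3_at_ge0 ?addr_ge0.
Qed.

(** Energy conservation makes every post-collisional triple admissible in the last hypothesis, so
    the integrand is at most [M] times the kernel, whose integral in the unit direction [udir] is
    [nb]. *)
Lemma gain_le psi (v v1 v2 : 'rV[R]_d) (M : R) : relvel v v1 v2 != 0 ->
  0 < M -> (forall x, 0 <= psi x) ->
  (forall x y z, 0 <= x -> 0 <= y -> 0 <= z ->
    x + y + z = japanese v ^+ 2 + japanese v1 ^+ 2 + japanese v2 ^+ 2 ->
    psi x + psi y + psi z <= M) ->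
  (gain theta3 phi psi v v1 v2 <= (nb * M)%:E)%E.
Proof.
move=> u0 M0 psi0 psiM; case: hb3 => _ _ _ /(_ _ (enorm_udir u0)) nbE.
rewrite mulrC EFinM -nbE; apply: ge0_integral_leZ => // t t1.
  by rewrite lee_fin mulr_ge0 ?b3_at_ge0 ?addr_ge0.
rewrite -EFinM lee_fin mulrC ler_wpM2r ?b3_at_ge0//.
by apply: psiM; rewrite ?sqr_ge0// post_energy.
Qed.

Lemma eq_gain psi1 psi2 (v v1 v2 : 'rV[R]_d) :
  (forall x, x <= japanese v ^+ 2 + japanese v1 ^+ 2 + japanese v2 ^+ 2 ->
    psi1 x = psi2 x) ->
  gain theta3 phi psi1 v v1 v2 = gain theta3 phi psi2 v v1 v2.
Proof.
move=> psiE; apply: eq_integral => t /set_mem t1.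
have E := post_energy v v1 v2 t1; have s0 n (x : 'rV[R]_n) := sqr_ge0 (japanese x).
rewrite !psiE// -E; first by rewrite lerDr addr_ge0.
- by rewrite -addrA addrCA lerDl addr_ge0.
- by rewrite -addrA lerDl addr_ge0.
Qed.

End gain_bounds.

Lemma psi_approx_eq (R : realType) (psi : R -> R) n (x : R) : x <= n%:R ->
  psi_approx psi n x = psi x.
Proof. by rewrite /psi_approx => ->. Qed.

Lemma powR_sqr (R : realType) (x k : R) : 0 <= x -> (x ^+ 2) `^ (k / 2) = x `^ k.
Proof.
by move=> x0; rewrite -powR_mulrn// -powRrM; congr (_ `^ _); field.
Qed.

(** The values decrease to 0, so the one at [k + 1] is already nonnegative, and the one at [k] is
    strictly larger. *)
Lemma ternary_coercive_map_gt0 (R : realType) d (theta3 : R) phi nb lam (k : R) :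
  ternary_coercive_map d theta3 phi nb lam -> 2 <= k -> 0 < lam (k / 2).
Proof.
case=> _ lamD lam0 _ k2; have k1k : k < k + 1 by rewrite ltrDl.
apply: le_lt_trans (lamD _ _ k2 k1k).
rewrite -(cvg_lim _ lam0)//; apply: limr_le; first by apply/cvg_ex; exists 0.
near=> l; apply/ltW/lamD; last by near: l; apply: nbhs_pinfty_gt; exact: num_real.
by rewrite (le_trans k2)// ltW.
Unshelve. all: by end_near. Qed.

Theorem lemma3p5 (R : realType) (d : nat) (theta3 : R) (phi : R -> R) (nb : R)
    (lam : R -> R) (k : R)
    (hd : (2 <= d)%N)
    (hb3 : angular_kernel d theta3 phi nb)
    (hlam : ternary_coercive_map d theta3 phi nb lam)
    (hk : 2 < k) :
  let psi := fun x : R => x `^ (k / 2) in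
  exists2 C : R, 1 < C &
  exists Gt Lt : 'rV[R]_d -> 'rV[R]_d -> 'rV[R]_d -> R,
    (forall v v1 v2 : 'rV[R]_d, relvel v v1 v2 != 0 ->
      [/\ K3 theta3 phi nb psi v v1 v2 = (Gt v v1 v2 - Lt v v1 v2)%:E,
          0 <= Gt v v1 v2,
          Gt v v1 v2 <= lam (k / 2) * C * cross_weight k v v1 v2 &
          (nb - lam (k / 2)) *
            (japanese v `^ k + japanese v1 `^ k + japanese v2 `^ k)
            <= Lt v v1 v2]) /\
    exists Gn Ln : nat -> 'rV[R]_d -> 'rV[R]_d -> 'rV[R]_d -> R,
      (forall (n : nat) (v v1 v2 : 'rV[R]_d), (1 <= n)%N ->
        relvel v v1 v2 != 0 ->
        [/\ K3 theta3 phi nb (psi_approx psi n) v v1 v2 =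
              (Gn n v v1 v2 - Ln n v v1 v2)%:E,
            0 <= Gn n v v1 v2,
            Gn n v v1 v2 <= C * cross_weight k v v1 v2 &
            0 <= Ln n v v1 v2]) /\
      (forall v v1 v2 : 'rV[R]_d, relvel v v1 v2 != 0 ->
        Ln n v v1 v2 @[n --> \oo] --> Lt v v1 v2).
Proof.
move=> psi.
have p1 : 1 < k / 2 by rewrite ltr_pdivlMr ?mul1r.
have lam_gt0 := ternary_coercive_map_gt0 hlam (ltW hk).
have [lam1 lamD _ lamG] := hlam.
have lam_lt : lam (k / 2) < nb.
  by have := lamD 2 k (lexx 2) hk; rewrite divff// lam1.
have nb0 := lt_trans lam_gt0 lam_lt.
pose E (v v1 v2 : 'rV[R]_d) := japanese v ^+ 2 + japanese v1 ^+ 2 + japanese v2 ^+ 2.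
have jge0 (v : 'rV[R]_d) : 0 <= japanese v by exact: sqrtr_ge0.
have j2gt0 (v : 'rV[R]_d) : 0 < japanese v ^+ 2.
  by rewrite japanese_sqr ltr_pwDl// dotp_ge0.
have E0 v v1 v2 : 0 < E v v1 v2 by rewrite !addr_gt0.
pose S f (v v1 v2 : 'rV[R]_d) : R :=
  f (japanese v ^+ 2) + f (japanese v1 ^+ 2) + f (japanese v2 ^+ 2).
pose A := k / 2 * 3 `^ (k / 2 - 1).
have A0 : 0 <= A by rewrite mulr_ge0 ?powR_ge0//; lra.
have W0 (v v1 v2 : 'rV[R]_d) : 0 <= cross_weight k v v1 v2.
  by rewrite mulr_ge0 ?addr_ge0 ?mulr_ge0 ?powR_ge0.
have psi0 x : 0 <= psi x by exact: powR_ge0.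
have SE v v1 v2 : S psi v v1 v2 = japanese v `^ k + japanese v1 `^ k + japanese v2 `^ k.
  by rewrite /S /psi !powR_sqr.
have psin_cross n v v1 v2 : (1 <= n)%N ->
    psi_approx psi n (E v v1 v2) - S (psi_approx psi n) v v1 v2 <= A * cross_weight k v v1 v2.
  by move=> n1; exact: psi_approx_cross.
have psin0 n x : (1 <= n)%N -> 0 <= psi_approx psi n x.
  by move=> n1; exact: psi_approx_powR_ge0.
have S_eq n v v1 v2 : E v v1 v2 <= n%:R -> S (psi_approx psi n) v v1 v2 = S psi v v1 v2.
  rewrite /E => En; have := j2gt0 v; have := j2gt0 v1; have := j2gt0 v2 => *.
  by rewrite /S !psi_approx_eq//; lra.
have psi_cross v v1 v2 : psi (E v v1 v2) - S psi v v1 v2 <= A * cross_weight k v v1 v2.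
  (* The estimate for [psi] is that for [psi_n] with [n] beyond the energy, where the two agree at
     all arguments involved. *)
  pose n := (Num.trunc (E v v1 v2)).+1.
  have En : E v v1 v2 <= n%:R by rewrite ltW// truncnS_gt.
  by rewrite -(S_eq n)// -(psi_approx_eq psi En); exact: psin_cross.
have gain_psi v v1 v2 : relvel v v1 v2 != 0 ->
    (gain theta3 phi psi v v1 v2 <= (lam (k / 2) * psi (E v v1 v2))%:E)%E.
  move=> u0; apply: le_trans (lamG k v v1 v2 (ltW hk) u0).
  rewrite le_eqVlt; apply/orP; left; apply/eqP; apply: eq_integral => t _.
  by rewrite /psi !powR_sqr// sqrtr_ge0.
have gain_psin n v v1 v2 : (1 <= n)%N -> relvel v v1 v2 != 0 ->
    (gain theta3 phi (psi_approx psi n) v v1 v2 <=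
      (nb * psi_approx psi n (E v v1 v2))%:E)%E.
  move=> n1 u0; apply: gain_le => //.
  - exact: psi_approx_powR_gt0.
  - by move=> x; exact: psin0.
  - move=> x y z x0 y0 z0 s; rewrite -/(E v v1 v2) in s; rewrite -s.
    by apply: psi_approx_powR_sum => //; rewrite s.
(* The upper bounds just obtained make these gains finite, so [fine] loses nothing. *)
pose g (f : R -> R) (v v1 v2 : 'rV[R]_d) : R := fine (gain theta3 phi f v v1 v2).
(* Any real [X] may serve as the gain part, provided the loss part absorbs it. *)
have K3E (f : R -> R) (v v1 v2 : 'rV[R]_d) (M X : R) : (forall x, 0 <= f x) ->
    (gain theta3 phi f v v1 v2 <= M%:E)%E ->
    K3 theta3 phi nb f v v1 v2 = (X - (nb * S f v v1 v2 - g f v v1 v2 + X))%:E.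
  move=> f0 gM; rewrite /K3 -[gain _ _ _ _ _ _]fineK.
    by rewrite -EFinB; congr EFin; rewrite /loss -/(S f v v1 v2) /g; ring.
  by rewrite ge0_fin_numE ?(gain_ge0 hb3)//; exact: le_lt_trans gM (ltry _).
have g_le (f : R -> R) (v v1 v2 : 'rV[R]_d) (M : R) : (forall x, 0 <= f x) ->
    (gain theta3 phi f v v1 v2 <= M%:E)%E -> g f v v1 v2 <= M.
  move=> f0 gM; rewrite -lee_fin fineK//.
  by rewrite ge0_fin_numE ?(gain_ge0 hb3)//; exact: le_lt_trans gM (ltry _).
(* The least nonnegative choice for which the loss part satisfies the required lower bound. *)
pose Gt (v v1 v2 : 'rV[R]_d) := Num.max 0 (g psi v v1 v2 - lam (k / 2) * S psi v v1 v2).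
pose Gn n v v1 v2 := if E v v1 v2 <= n%:R then Gt v v1 v2 else
  Num.max 0 (g (psi_approx psi n) v v1 v2 - nb * S (psi_approx psi n) v v1 v2).
pose L (f : R -> R) (G : 'rV[R]_d -> 'rV[R]_d -> 'rV[R]_d -> R) (v v1 v2 : 'rV[R]_d) : R := nb * S f v v1 v2 - g f v v1 v2 + G v v1 v2.
have GtP (v v1 v2 : 'rV[R]_d) : relvel v v1 v2 != 0 ->
    Gt v v1 v2 <= lam (k / 2) * (A * cross_weight k v v1 v2).
  move=> u0; rewrite ge_max mulr_ge0 ?(mulr_ge0 A0) ?(ltW lam_gt0)//=.
  have := g_le _ _ _ _ _ psi0 (gain_psi _ _ _ u0).
  have := psi_cross v v1 v2; rewrite -(ler_pM2l lam_gt0); lra.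
have LtP (v v1 v2 : 'rV[R]_d) : (nb - lam (k / 2)) * S psi v v1 v2 <= L psi Gt v v1 v2.
  rewrite /L; have : g psi v v1 v2 - lam (k / 2) * S psi v v1 v2 <= Gt v v1 v2.
    by rewrite le_max lexx orbT.
  lra.
have L_eq n v v1 v2 : E v v1 v2 <= n%:R ->
    L (psi_approx psi n) (Gn n) v v1 v2 = L psi Gt v v1 v2.
  move=> En; rewrite /L /Gn En S_eq//; congr (_ - fine _ + _).
  by apply: eq_gain => x xE; rewrite psi_approx_eq// (le_trans xE).
have S0 (f : R -> R) v v1 v2 : (forall x, 0 <= f x) -> 0 <= S f v v1 v2 by move=> f0; rewrite !addr_ge0.
(* Large enough to exceed 1, [A] (used for [Gt]) and [nb * A] (used for [Gn]). *)
exists (1 + (1 + nb) * (1 + A)); first by rewrite ltrDl mulr_gt0//; lra.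
exists Gt, (L psi Gt); split.
  move=> v v1 v2 u0; split.
  - exact: K3E psi0 (gain_psi _ _ _ u0).
  - by rewrite le_max lexx.
  - apply: le_trans (GtP _ _ _ u0) _; rewrite -mulrA ler_pM2l// ler_wpM2r//.
    have := mulr_ge0 (ltW nb0) A0; lra.
  - by rewrite -SE.
exists Gn, (fun n => L (psi_approx psi n) (Gn n)); split; last first.
  (* The sequence is constant once [n] reaches the energy. *)
  move=> v v1 v2 u0; apply: cvg_near_cst; near=> n; apply/L_eq.
  by near: n; exact: nbhs_infty_ger.
move=> n v v1 v2 n1 u0; split.
- exact: K3E (fun x => psin0 n x n1) (gain_psin _ _ _ _ n1 u0).
- by rewrite /Gn; case: ifP => _; rewrite le_max lexx.
- have WA := mulr_ge0 A0 (W0 v v1 v2).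
  apply: (@le_trans _ _ (nb * (A * cross_weight k v v1 v2))).
    rewrite /Gn; case: ifP => _.
      by apply: le_trans (GtP _ _ _ u0) _; rewrite ler_wpM2r// ltW.
    rewrite ge_max mulr_ge0 ?(ltW nb0)//=.
    have := g_le _ _ _ _ _ (fun x => psin0 n x n1) (gain_psin _ _ _ _ n1 u0).
    have := psin_cross n v v1 v2 n1; rewrite -(ler_pM2l nb0); lra.
  rewrite mulrA ler_wpM2r//; lra.
(* Past the energy the loss part is that of [psi], nonnegative since [lam (k / 2) < nb]; before it,
   it is [loss - gain] plus the positive part of [gain - loss]. *)
- have [En|nE] := leP (E v v1 v2) n%:R.
    rewrite L_eq//; apply: le_trans (LtP _ _ _).
    by rewrite mulr_ge0 ?S0 ?subr_ge0 ?ltW.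
  rewrite /L /Gn (leNgt (E v v1 v2)) nE /=.
  by rewrite -lerBlDl sub0r opprB le_max lexx orbT.
Unshelve. all: by end_near. Qed.
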